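(* Let $\Omega\subseteq\mathbb{R}^n$ be an open connected set, let $f_1,\dots,f_n:\Omega\to\mathbb{R}$ be non-negative smooth functions, let $\omega$ be a $1$-form on $\Omega$ with coefficients $b_i(p)=\omega_p\left(\frac{\partial}{\partial p^i}\right)$, and let $\alpha,\beta$ be conjugate exponents ($\frac1\alpha+\frac1\beta=1$) with $1<\alpha<\infty$. Let $F$ be the Finsler metric on $\Omega$ given by $$F(p,v)=\left(\sum_{i=1}^n f_i(p)|v^i|^\alpha\right)^{\frac1\alpha}+\sum_{i=1}^n b_i(p)\,\big(f_i(p)\big)^{\frac1\alpha}v^i ,$$ and let $c$ be a real number with $\|b(p)\|_\beta=\left(\sum_{i=1}^n|b_i(p)|^\beta\right)^{1/\beta}\le c<1$ for all $p\in\Omega$. Then for every finite set $X\subset\Omega$ and every $\varepsilon>0$, $$\check{C}ech^-(X,\varepsilon)\subseteq\check{C}ech^+\left(X,\frac{\varepsilon(1+c)}{1-c}\right)\subseteq\check{C}ech^-\left(X,\frac{\varepsilon(1+c)^2}{(1-c)^2}\right).$$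
   Context: A Finsler metric on an open set $\Omega\subseteq\mathbb{R}^n$ is a continuous function $F: T\Omega \cong \Omega\times\mathbb{R}^n \to \mathbb{R}$ such that: (i) $F$ is $C^\infty$ on $\{(p,v): v\neq 0\}$; (ii) $F(p,v)>0$ for $v\ne 0$; (iii) $F(p,rv)=rF(p,v)$ for all $r>0$; (iv) the matrix $g_{ij}(p,v)=\frac12\frac{\partial^2 F^2}{\partial v^i\partial v^j}(p,v)$ is positive definite for $v\neq 0$. Write $F_p(v)=F(p,v)$ and identify each tangent space $T_p\Omega$ with $\mathbb{R}^n$. For $p\in\Omega$ and $\varepsilon>0$, the forward and backward balls centered at $p$ are $$\mathcal{B}^+(p,\varepsilon)=\{w\in\mathbb{R}^n: F_p(w-p)\le\varepsilon\},\qquad \mathcal{B}^-(p,\varepsilon)=\{w\in\mathbb{R}^n: F_p(p-w)\le\varepsilon\}.$$ For a finite set $X\subset\Omega$, $\check{C}ech^{\pm}(X,\varepsilon)$ is the abstract simplicial complex with vertex set $X$ in which $\{p_1,\dots,p_{k+1}\}\subset X$ spans a $k$-simplex iff $\bigcap_{i=1}^{k+1}\mathcal{B}^{\pm}(p_i,\varepsilon)\ne\emptyset$. *)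

(* Defs.v *)
From mathcomp Require Import all_boot all_order all_algebra.
From mathcomp Require Import all_classical all_reals all_analysis.

Set Implicit Arguments.
Unset Strict Implicit.
Unset Printing Implicit Defensive.

Import Order.TTheory GRing.Theory Num.Theory.
Import numFieldNormedType.Exports.

Local Open Scope classical_set_scope.
Local Open Scope ring_scope.

(* Functions on an open set U are represented by total functions of which only
   the values on U matter. The derivatives below are taken along all vectors of
   the (finite-dimensional) space V rather than along a chosen basis, so that
   V can be R^n or R^n x R^n. *)
Fixpoint Ck_on (R : realType) (V : normedModType R) (k : nat)
    (U : set V) (f : V -> R) : Prop :=
  {in U, continuous f} /\
  (if k is k'.+1 then
     forall v : V, {in U, forall x, derivable f x v} /\
       Ck_on k' U (fun x => 'D_v f x)
   else True).

Definition smooth_on (R : realType) (V : normedModType R)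
    (U : set V) (f : V -> R) : Prop :=
  forall k, Ck_on k U f.

Section Finsler.
Variables (R : realType) (n : nat).
Local Notation V := 'rV[R]_n.

Definition std_basis (i : 'I_n) : V := delta_mx 0 i.

Definition posdefmx (A : 'M[R]_n) : Prop :=
  forall u : V, u != 0 -> 0 < (u *m A *m u^T) 0 0.

Definition fundamental_tensor (F : V -> V -> R) (p v : V) : 'M[R]_n :=
  \matrix_(i, j) (2^-1 *
    'D_(std_basis i) (fun v' => 'D_(std_basis j) (fun w => F p w ^+ 2) v') v).

Record finsler_metric (Omega : set V) (F : V -> V -> R) : Prop := {
  finsler_continuous :
    {within Omega `*` setT, continuous (fun pv : V * V => F pv.1 pv.2)};
  finsler_smooth :
    smooth_on [set pv : V * V | Omega pv.1 /\ pv.2 != 0]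
      (fun pv => F pv.1 pv.2);
  finsler_gt0 : forall p v, Omega p -> v != 0 -> 0 < F p v;
  finsler_homogeneous : forall p v (r : R),
    Omega p -> 0 < r -> F p (r *: v) = r * F p v;
  finsler_posdef : forall p v,
    Omega p -> v != 0 -> posdefmx (fundamental_tensor F p v) }.

Definition one_form_coef (omega : V -> {linear V -> R^o}) (p : V) (i : 'I_n)
    : R :=
  omega p (std_basis i).

Definition smooth_one_form (Omega : set V) (omega : V -> {linear V -> R^o}) :=
  forall i, smooth_on Omega (fun p => one_form_coef omega p i).

Definition forward_ball (F : V -> V -> R) (p : V) (eps : R) : set V :=
  [set w | F p (w - p) <= eps].

Definition backward_ball (F : V -> V -> R) (p : V) (eps : R) : set V :=
  [set w | F p (p - w) <= eps].

End Finsler.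

Definition simplicial_complex (T : Type) (X : set T) (K : set (set T)) : Prop :=
  [/\ forall s, K s -> [/\ s `<=` X, finite_set s & s !=set0],
      forall x, X x -> K [set x] &
      forall s t, K s -> t `<=` s -> t !=set0 -> K t].

(* A complex is given by its set of simplices, a simplex being identified with
   its set of vertices; one complex is contained in another when every simplex
   of the first is a simplex of the second. *)
Definition nerve_complex (T : Type) (B : T -> set T) (X : set T)
    : set (set T) :=
  [set s | [/\ s `<=` X, s !=set0 & (\bigcap_(p in s) B p) !=set0]].

Definition cech_forward (R : realType) (n : nat)
    (F : 'rV[R]_n -> 'rV[R]_n -> R) (X : set 'rV[R]_n) (eps : R) :=
  nerve_complex (fun p => forward_ball F p eps) X.

Definition cech_backward (R : realType) (n : nat)
    (F : 'rV[R]_n -> 'rV[R]_n -> R) (X : set 'rV[R]_n) (eps : R) :=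
  nerve_complex (fun p => backward_ball F p eps) X.

Lemma nerve_complex_simplicial (T : Type) (B : T -> set T) (X : set T) :
  finite_set X -> (forall p, X p -> B p p) ->
  simplicial_complex X (nerve_complex B X).
Proof.
move=> finX Bpp; split.
- by move=> s [sX s0 _]; split=> //; exact: sub_finite_set finX.
- move=> x Xx; split; first by move=> y ->.
    by exists x.
  by exists x => y /= ->; exact: Bpp.
- move=> s t [sX _ [w ws]] ts t0; split=> //.
    exact: subset_trans sX.
  by exists w => y ty; apply: ws; exact: ts.
Qed.

Lemma finsler_metric0 (R : realType) (n : nat) (Omega : set 'rV[R]_n)
    (F : 'rV[R]_n -> 'rV[R]_n -> R) (p : 'rV[R]_n) :
  finsler_metric Omega F -> Omega p -> F p 0 = 0.
Proof.
move=> [_ _ _ hom _] Op; have := hom p 0 2 Op (ltr0Sn _ _).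
rewrite scaler0 mulr_natl mulr2n => /eqP.
by rewrite -subr_eq0 opprD addNKr oppr_eq0 => /eqP.
Qed.

Lemma cech_simplicial (R : realType) (n : nat) (Omega X : set 'rV[R]_n)
    (F : 'rV[R]_n -> 'rV[R]_n -> R) (eps : R) :
  finsler_metric Omega F -> finite_set X -> X `<=` Omega -> 0 < eps ->
  simplicial_complex X (cech_forward F X eps) /\
  simplicial_complex X (cech_backward F X eps).
Proof.
move=> FF finX XO eps0; split; apply: nerve_complex_simplicial => // p Xp;
  by rewrite /forward_ball /backward_ball /= subrr
             (finsler_metric0 FF (XO _ Xp)) ltW.
Qed.

(* Main.v *)
(* Write [A v] for the [alpha]-norm of the vector with entries
   [f i p `^ alpha^-1 * v 0 i], and [l v] for the linear part of [F p v].
   Hoelder's inequality gives [`|l v| <= c * A v], hence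
   [(1 - c) * A v <= F p v <= (1 + c) * A v]; as [A] is even,
   [F p (- v) <= (1 + c) / (1 - c) * F p v]. So each backward ball lies in the
   forward ball with radius scaled by [(1 + c) / (1 - c)], and conversely, and
   nerves are monotone in the balls. *)

Require Import Defs.
From mathcomp Require Import all_boot all_order all_algebra.
From mathcomp Require Import all_classical all_reals all_analysis.
From mathcomp Require Import lra.

Import Order.TTheory GRing.Theory Num.Theory.
Import numFieldNormedType.Exports.

Local Open Scope classical_set_scope.
Local Open Scope ring_scope.

(** Induction on [r]: the two-term inequality [hoelder2] is applied to the head entries and to the
    two roots that bound the tail. Raising these roots back to [p] and [q] restores the tail
    sums. *)
Lemma hoelder_sum (R : realType) (I : Type) (r : seq I) (P : pred I)
    (x y : I -> R) (p q : R) :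
  0 < p -> 0 < q -> p^-1 + q^-1 = 1 ->
  (forall i, P i -> 0 <= x i) -> (forall i, P i -> 0 <= y i) ->
  \sum_(i <- r | P i) x i * y i <=
    (\sum_(i <- r | P i) x i `^ p) `^ p^-1 *
    (\sum_(i <- r | P i) y i `^ q) `^ q^-1.
Proof.
move=> p0 q0 pq x0 y0; elim: r => [|i r IHr].
  by rewrite !big_nil mulr_ge0 ?powR_ge0.
rewrite !big_cons; case: ifPn => // Pi.
apply: (le_trans (lerD (lexx _) IHr)).
have powRVK (a s : R) : 0 < s -> 0 <= a -> (a `^ s^-1) `^ s = a.
  by move=> s0 a0; rewrite -powRrM mulVf ?powRr1 ?gt_eqF.
apply: le_trans (hoelder2 (x0 _ Pi) _ (y0 _ Pi) _ p0 q0 pq) _;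
  rewrite ?powR_ge0//.
by rewrite !powRVK//; apply: sumr_ge0 => j _; exact: powR_ge0.
Qed.

Lemma nerve_complexS (T : Type) (B B' : T -> set T) (X : set T) :
  (forall p, X p -> B p `<=` B' p) -> nerve_complex B X `<=` nerve_complex B' X.
Proof.
move=> BB' s [sX s0 [w ws]]; split=> //.
by exists w => p sp; apply: BB' (sX _ sp) _ (ws _ sp).
Qed.

(** Once the denominator is cleared, the right side exceeds the left by [2 * (c * a + l)]. *)
Lemma reversibility_bound (R : realFieldType) (a l c : R) :
  c < 1 -> `|l| <= c * a -> a - l <= (1 + c) / (1 - c) * (a + l).
Proof.
move=> c1; rewrite ler_norml => /andP[la al].
have c1' : 0 < 1 - c by rewrite subr_gt0.
rewrite mulrAC ler_pdivlMr//; lra.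
Qed.

Theorem proposition13 (R : realType) (n : nat) (Omega : set 'rV[R]_n)
    (f : 'I_n -> 'rV[R]_n -> R)
    (omega : 'rV[R]_n -> {linear 'rV[R]_n -> R^o})
    (alpha beta c : R) (F : 'rV[R]_n -> 'rV[R]_n -> R) :
  open Omega -> connected Omega ->
  (forall i, smooth_on Omega (f i)) ->
  (forall i p, Omega p -> 0 <= f i p) ->
  smooth_one_form Omega omega ->
  1 < alpha -> alpha^-1 + beta^-1 = 1 ->
  finsler_metric Omega F ->
  (forall p v, Omega p ->
     F p v = (\sum_(i < n) f i p * `|v 0 i| `^ alpha) `^ alpha^-1 +
             \sum_(i < n) one_form_coef omega p i * f i p `^ alpha^-1 * v 0 i) ->
  (forall p, Omega p ->
     (\sum_(i < n) `|one_form_coef omega p i| `^ beta) `^ beta^-1 <= c) ->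
  c < 1 ->
  forall (X : set 'rV[R]_n) (eps : R),
    finite_set X -> X `<=` Omega -> 0 < eps ->
    cech_backward F X eps `<=` cech_forward F X (eps * (1 + c) / (1 - c)) /\
    cech_forward F X (eps * (1 + c) / (1 - c)) `<=`
      cech_backward F X (eps * (1 + c) ^+ 2 / (1 - c) ^+ 2).
Proof.
move=> _ _ _ f0 _ alpha1 ab _ FE bc c1 X eps _ XO _.
have alpha0 : 0 < alpha by rewrite (lt_trans _ alpha1).
have beta0 : 0 < beta.
  have -> : beta = (1 - alpha^-1)^-1 by rewrite -ab addrC addKr invrK.
  by rewrite invr_gt0 subr_gt0 invf_lt1.
have Frev p v : Omega p -> F p (- v) <= (1 + c) / (1 - c) * F p v.
  move=> Op; rewrite !FE//.
  under eq_bigr do rewrite mxE normrN.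
  under [X in _ + X <= _]eq_bigr do rewrite mxE mulrN.
  rewrite sumrN; apply: reversibility_bound => //.
  apply: (le_trans (ler_norm_sum _ _ _)).
  under [X in X <= _]eq_bigr do rewrite -mulrA normrM.
  (* The exponent [beta] goes to the coefficients of [omega], whose norm is at most [c], and [alpha]
     to the weighted entries of [v]. As [f i p] is nonnegative, its root raised to [alpha] is
     [f i p] again, so the second factor is the first term of [F p v]. *)
  apply: le_trans (hoelder_sum _ _ _ _ _ _ _ _ beta0 alpha0 _ _ _) _ => //.
    by rewrite addrC.
  under [in X in _ * X <= _]eq_bigr => i _.
    rewrite normrM (ger0_norm (powR_ge0 _ _)) powRM ?powR_ge0//.
    rewrite -powRrM mulVf ?gt_eqF// powRr1 ?f0//; over.
  by rewrite ler_wpM2r ?powR_ge0 ?bc.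
have Fscale p v (r : R) : Omega p -> F p v <= r ->
    F p (- v) <= (1 + c) / (1 - c) * r.
  move=> Op Fr; apply: (le_trans (Frev _ _ Op)).
  (* The sign of [c] comes from the norm it bounds, which takes a point of [Omega]. *)
  have c0 : 0 <= c by apply: le_trans (bc _ Op); exact: powR_ge0.
  by rewrite ler_wpM2l// divr_ge0 ?subr_ge0 ?addr_ge0// ltW.
split; apply: nerve_complexS => p /XO Op w;
  rewrite /forward_ball /backward_ball /= => /(Fscale _ _ _ Op);
  rewrite opprB => /le_trans; apply.
  by rewrite mulrC mulrA.
(* The radius already carries one factor [l / k]; the second reversal adds another, hence the
   squares. *)
set k := 1 - c; set l := 1 + c.
suff -> : l / k * (eps * l / k) = eps * l ^+ 2 / k ^+ 2 by [].
by rewrite mulrACA -invfM mulrCA -!expr2.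
Qed.
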